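(* Let $n$ be a positive integer with $n\equiv 0\pmod 2$ and let $k$ be an integer with $1\le k\le\frac n2$. Let $\Gamma_{\mathrm{IV}}^k(n)$ be the graph whose vertices are all Type IV codes of length $n$, two vertices being joined by an edge if and only if they are $k$-neighbors. Then: (a) the number of vertices of $\Gamma_{\mathrm{IV}}^k(n)$ is $\prod_{i=0}^{\frac n2-1}(2^{2i+1}+1)$; (b) $\Gamma_{\mathrm{IV}}^k(n)$ is regular of degree $$\frac{\prod_{i=0}^{k-1}\left(2^{\,2n-1-2i}-2^{\,n-1}\right)}{\prod_{j=0}^{k-1}\left(2^{n}-2^{\,n-2-2j}\right)};$$ (c) the number of edges of $\Gamma_{\mathrm{IV}}^k(n)$ is $$\frac12\left(\prod_{i=0}^{\frac n2-1}(2^{2i+1}+1)\right)\frac{\prod_{i=0}^{k-1}\left(2^{\,2n-1-2i}-2^{\,n-1}\right)}{\prod_{j=0}^{k-1}\left(2^{n}-2^{\,n-2-2j}\right)}.$$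
   Context: Equip $\mathbb{F}_4^n$ with the Hermitian inner product $u\cdot v=\sum_{i=1}^n u_iv_i^2$. A code of length $n$ over $\mathbb{F}_4$ is an $\mathbb{F}_4$-linear subspace $C\subseteq\mathbb{F}_4^n$; its dual is $C^\perp=\{v\in\mathbb{F}_4^n : u\cdot v=0\text{ for all }u\in C\}$, and $C$ is self-dual if $C=C^\perp$ (so $\dim C=n/2$). The weight of a vector is its number of nonzero coordinates. A Type IV code is a self-dual code over $\mathbb{F}_4$ in which every codeword has even weight. Codes are counted as subspaces (not up to equivalence). Two self-dual codes $C,D$ of length $n$ are $k$-neighbors if $\dim(C\cap D)=\frac n2-k$. *)

(* Defs.v *)
From HB Require Import structures.
From mathcomp Require Import all_boot all_order all_algebra.

Set Implicit Arguments.
Unset Strict Implicit.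
Unset Printing Implicit Defensive.

Import GRing.Theory.

Local Open Scope ring_scope.

(* The library gives {vspace vT} no finType structure; over a finite field it
   inherits one from the canonical matrices that represent subspaces. *)
HB.instance Definition _ (F : finFieldType) (vT : vectType F) :=
  Countable.copy {vspace vT} (can_type (@VectorInternalTheory.vs2mxK F vT)).
HB.instance Definition _ (F : finFieldType) (vT : vectType F) :
  isFinite {vspace vT} := CanIsFinite (@VectorInternalTheory.vs2mxK F vT).

Section Codes.
Variables (F : finFieldType) (n : nat).
Implicit Types (u v : 'rV[F]_n) (C D : {vspace 'rV[F]_n}).

(* This is the Hermitian inner product when F has four elements, squaring
   then being the nontrivial field automorphism. *)
Definition herm u v : F := \sum_(i < n) u 0 i * v 0 i ^+ 2.

Definition dual_code C : {set 'rV[F]_n} :=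
  [set v | [forall u in C, herm u v == 0]].

Definition self_dual C : bool := [set v in C] == dual_code C.

Definition weight v : nat := #|[set i | v 0 i != 0]|.

Definition type_IV C : bool :=
  self_dual C && [forall v in C, ~~ odd (weight v)].

(* The subtraction is truncated, so this is meaningful only for k <= n./2. *)
Definition neighbors (k : nat) C D : bool :=
  [&& self_dual C, self_dual D & \dim (C :&: D) == (n./2 - k)%N].

End Codes.

(* gadj only matters between vertices.  Symmetry and irreflexivity are not
   recorded: for Gamma_IV they hold when 1 <= k <= n./2, a self-dual code of
   even length n having dimension n./2. *)
Record graph (T : finType) := Graph { gvert : {set T}; gadj : rel T }.

Definition degree (T : finType) (G : graph T) (x : T) : nat :=
  #|[set y in gvert G | gadj G x y]|.

Definition edges (T : finType) (G : graph T) : {set {set T}} :=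
  [set [set x; y] | x in gvert G, y in gvert G & gadj G x y].

Definition Gamma_IV (F : finFieldType) (n k : nat)
    : graph {vspace 'rV[F]_n} :=
  Graph [set C | type_IV C] (@neighbors F n k).

(* Main.v *)
Require Import Defs.
From mathcomp Require Import all_boot all_order all_algebra.
From mathcomp Require Import finfield ring zify.

(** Over the field of four elements the Hermitian norm of a vector is its
    weight modulo 2, so every self-dual code is of Type IV and the graph lives
    on the maximal totally isotropic subspaces of a Hermitian space of
    dimension n = 2m.

    Fix a self-dual code C and let M_j be the number of self-dual D with
    dim (C :&: D) = j.  Everything follows from one double count.  For v in C
    and an isotropic w with <v, w> != 0, the operation
    D |-> switch D v = (D :&: v^perp) + <v> is a bijection from the self-dual
    codes that contain w onto those that contain v, with inverse
    D' |-> switch D' w, and it increases dim (C :&: D) by exactly one because v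
    lies in C (card_meeting_switch).  Summing over all pairs (v, w), and using
    that for v != 0 in C exactly half of the vectors not orthogonal to v are
    isotropic (card_iso_nonorth), gives
      2 M_j (4^m - 4^j) = M_(j+1) (4^(j+1) - 1) 4^m
    (card_meeting_rec).  As M_m = 1, this determines every M_j: the number of
    k-neighbors of C is the stated quotient of products, whatever C is.

    For the number of vertices, M_(m-k) turns out to be 2^(k^2) times the
    Gaussian binomial coefficient of m and k in base 4.  These numbers also obey
    a Pascal rule (hbinom), so that their sum over k is a product; this is the
    q-binomial theorem at one point.  That sum counts all self-dual codes, as
    soon as there is one to play the role of C, and the repetition code (x | x)
    does.  The number of edges follows by the handshake lemma
    (double_card_edges). *)

Set Implicit Arguments.
Unset Strict Implicit.
Unset Printing Implicit Defensive.

Import GRing.Theory.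

Local Open Scope ring_scope.

(** * The field of four elements *)

Section FieldOfFour.
Variable F : finFieldType.
Hypothesis F4 : #|F| = 4%N.
Implicit Types x y : F.

Lemma expr4_F4 x : x ^+ 4 = x.
Proof. by rewrite -[RHS]expf_card F4. Qed.

Lemma pchar_F4 : 2 \in [pchar F].
Proof.
have N1 : (-1 : F) = 1 by rewrite -[LHS]expr4_F4 -signr_odd.
by rewrite inE /= mulr2n -{2}N1 subrr.
Qed.

Lemma sqrrD_F4 x y : (x + y) ^+ 2 = x ^+ 2 + y ^+ 2.
Proof. by rewrite sqrrD -mulr_natr (pcharf0 pchar_F4) mulr0 addr0. Qed.

Lemma expr3_F4 x : x ^+ 3 = (x != 0)%:R.
Proof.
have [->|x_n0] := eqVneq x 0; first by rewrite expr0n.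
by apply: (mulfI x_n0); rewrite -exprS expr4_F4 mulr1.
Qed.

(** The trace onto the prime field is onto: a primitive cube root of unity has
    trace 1. *)
Lemma ex_trace1_F4 : exists x, x + x ^+ 2 = 1.
Proof.
have /subsetPn[x _]: ~~ ([set: F] \subset [set 0; 1]).
  by apply/negP => /subset_leq_card; rewrite cardsT F4 cards2; case: (_ == _).
rewrite !inE negb_or => /andP[x_n0 x_n1]; exists x.
have x3 : x ^+ 3 - 1 = 0 by rewrite expr3_F4 x_n0 subrr.
have : (x - 1) * (x ^+ 2 + x + 1) = 0 by rewrite -x3; ring.
move/eqP; rewrite mulf_eq0 subr_eq0 (negPf x_n1) /= addr_eq0 => /eqP.
by rewrite (oppr_pchar2 pchar_F4) addrC.
Qed.

End FieldOfFour.

(** * The Hermitian form *)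

Section HermitianForm.
Variables (F : finFieldType) (n : nat).
Hypothesis F4 : #|F| = 4%N.
Implicit Types (u v w : 'rV[F]_n) (C D U : {vspace 'rV[F]_n}).

Lemma hermDl u v w : herm (u + v) w = herm u w + herm v w.
Proof. by rewrite /herm -big_split; apply: eq_bigr => i _; rewrite mxE mulrDl. Qed.

Lemma hermZl a u v : herm (a *: u) v = a * herm u v.
Proof. by rewrite mulr_sumr; apply: eq_bigr => i _; rewrite mxE mulrA. Qed.

Lemma hermC u v : herm v u = herm u v ^+ 2.
Proof.
rewrite /herm -[RHS](pFrobenius_autE (pchar_F4 F4)) rmorph_sum.
apply: eq_bigr => i _ /=.
by rewrite pFrobenius_autE exprMn mulrC -exprM expr4_F4.
Qed.

Lemma herm_eq0C u v : (herm v u == 0) = (herm u v == 0).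
Proof. by rewrite hermC expf_eq0. Qed.

Lemma hermDr u v w : herm u (v + w) = herm u v + herm u w.
Proof. by rewrite hermC hermDl sqrrD_F4 // -!hermC. Qed.

Lemma hermZr a u v : herm u (a *: v) = a ^+ 2 * herm u v.
Proof. by rewrite hermC hermZl exprMn -hermC. Qed.

(** Nonzero elements of the field are cube roots of unity, so the norm just
    counts the nonzero coordinates modulo 2. *)
Lemma herm_diag v : herm v v = (odd (weight v))%:R.
Proof.
transitivity (\sum_(i < n | v 0 i != 0) 1 : F).
  rewrite [RHS]big_mkcond; apply: eq_bigr => i _.
  by rewrite -exprS expr3_F4 //; case: ifP.
rewrite sumr_const /weight cardsE.
by rewrite -(GRing.natr_mod_pchar (pchar_F4 F4)) modn2.
Qed.

Lemma herm_nondegenerate v : v != 0 -> exists u, herm u v != 0.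
Proof.
case/rV0Pn => i vi_n0; exists (delta_mx 0 i).
rewrite /herm (bigD1 i) //= big1 => [|j /negPf j_ni]; rewrite mxE eqxx ?j_ni ?mul0r //=.
by rewrite eqxx mul1r addr0 expf_neq0.
Qed.

(** Orthogonality to [v] is the vanishing of one linear functional; presenting
    it as the kernel of a linear map into the scalars makes the dimension of its
    traces on subspaces available. *)
Definition orthv v : {vspace 'rV[F]_n} :=
  lker (linfun (mulmxr (map_mx (fun x => x ^+ 2) v)^T)).

Lemma memv_orthv u v : (u \in orthv v) = (herm u v == 0).
Proof.
rewrite memv_ker lfunE /=.
have -> : u *m (map_mx (fun x => x ^+ 2) v)^T = (herm u v)%:M.
  by apply/rowP => i; rewrite !mxE ord1 eqxx; apply: eq_bigr => j _; rewrite !mxE.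
by apply/eqP/eqP=> [/rowP/(_ 0)|->]; rewrite ?raddf0 // !mxE.
Qed.

Lemma dimv_cap_orthv U v :
  ~~ (U <= orthv v)%VS -> \dim U = (\dim (U :&: orthv v)).+1.
Proof.
pose f : 'Hom('rV[F]_n, 'rV[F]_1) :=
  linfun (mulmxr (map_mx (fun x => x ^+ 2) v)^T).
move=> nsub; rewrite -(limg_ker_dim f U) -[RHS]addn1; congr addn.
apply/eqP; rewrite eqn_leq lt0n dimv_eq0 -lkerE nsub andbT.
by apply: leq_trans (dimvS (subvf _)) _; rewrite dimvf.
Qed.

Lemma card_memv U : #|U| = (4 ^ \dim U)%N.
Proof. by rewrite card_vspace F4. Qed.

End HermitianForm.

(** * Self-dual codes and switching *)

Section SelfDual.
Variables (F : finFieldType) (n : nat).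
Hypothesis F4 : #|F| = 4%N.
Implicit Types (u v w : 'rV[F]_n) (C D E U : {vspace 'rV[F]_n}).

(** The truth value [U <= orthv v] used as a number lets this be summed
    over [v] or over [U] without case analysis. *)
Lemma card_cap_orthv U v :
  (4 * #|(U :&: orthv v)%VS| = #|U| + (U <= orthv v)%VS * 3 * #|U|)%N.
Proof.
rewrite !card_memv //; case: (boolP (U <= _)%VS) => [/capv_idPl ->|nsub].
  by rewrite mul1n -mulSn.
by rewrite !mul0n addn0 (dimv_cap_orthv nsub) expnS.
Qed.

Lemma mem_dual_code C v : (v \in dual_code C) = (C <= orthv v)%VS.
Proof.
rewrite inE; apply/forall_inP/subvP => h u /h; first by rewrite memv_orthv.
by rewrite memv_orthv.
Qed.

(** Count the orthogonal pairs (u, v) with u in C in two ways: a nonzero u is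
    orthogonal to a quarter of the space, and a vector outside of the dual to a
    quarter of C. *)
Lemma card_dual_code C : (#|C| * #|dual_code C| = 4 ^ n)%N.
Proof.
have cardT : #|{: 'rV[F]_n}%VS| = (4 ^ n)%N.
  by rewrite card_memv // dimvf /dim /= mul1n.
have sub_orthv u : ({: 'rV[F]_n} <= orthv u)%VS = (u == 0).
  apply/idP/eqP => [/subvP h|->].
    apply/eqP; apply: contraT => /herm_nondegenerate[v].
    by rewrite -memv_orthv h ?memvf.
  by apply/subvP => v _; rewrite memv_orthv herm_eq0C // -(scale0r 0) hermZl mul0r.
have swap : (\sum_v #|(C :&: orthv v)%VS| =
             \sum_(u in C) #|({: 'rV[F]_n} :&: orthv u)%VS|)%N.
  under eq_bigr do rewrite -sum1_card.
  under [RHS]eq_bigr do rewrite -sum1_card.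
  rewrite (exchange_big_dep (mem C)) /= => [|v u _]; last first.
    by rewrite memv_cap => /andP[].
  apply: eq_bigr => u uC; apply: eq_bigl => v.
  by rewrite !memv_cap !memv_orthv uC memvf herm_eq0C.
have := congr1 (muln 4) swap; rewrite !big_distrr /=.
under eq_bigr do rewrite card_cap_orthv -mem_dual_code.
under [in RHS]eq_bigr do rewrite card_cap_orthv sub_orthv cardT.
rewrite !big_split /= -!big_distrl /=.
rewrite !sum_nat_const.
have -> : #|fun _ : 'rV[F]_n => true| = (4 ^ n)%N.
  by rewrite -cardT; apply: eq_card => v; rewrite memvf.
have -> : (\sum_v (v \in dual_code C) = #|dual_code C|)%N.
  by rewrite -sum1_card [RHS]big_mkcond.
have -> : (\sum_(u in C) (u == 0%R) = 1)%N.
  by rewrite (bigD1 0%R) ?mem0v //= eqxx big1 // => u /andP[_ /negPf->].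
by move: #|C| #|dual_code C| (4 ^ n)%N => c d X; lia.
Qed.

Lemma self_dual_orthv C v : self_dual C -> (v \in C) = (C <= orthv v)%VS.
Proof. by move/eqP => defC; rewrite -mem_dual_code -defC inE. Qed.

Lemma self_dual_herm C : self_dual C -> {in C &, forall u v, herm u v = 0}.
Proof.
move=> sdC u v uC; rewrite (self_dual_orthv v sdC) => /subvP/(_ u uC).
by rewrite memv_orthv => /eqP.
Qed.

Lemma dim_self_dual C : self_dual C -> (\dim C).*2 = n.
Proof.
move/eqP => defC; apply: (@expnI 4) => //.
by rewrite -(card_dual_code C) -defC cardsE card_memv // -expnD addnn.
Qed.

Lemma isotropic_self_dual C :
  {in C &, forall u v, herm u v = 0} -> (\dim C).*2 = n -> self_dual C.
Proof.
move=> isoC dimC; rewrite /self_dual eqEcard; apply/andP; split.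
  apply/subsetP => v; rewrite inE mem_dual_code => vC.
  by apply/subvP => u uC; rewrite memv_orthv isoC.
rewrite -(@leq_pmul2l #|C|) ?card_dual_code; last by rewrite card_memv // expn_gt0.
by rewrite cardsE card_memv // -expnD addnn dimC.
Qed.

Lemma self_dual_sub_eq C D : self_dual C -> self_dual D -> (C <= D)%VS -> C = D.
Proof.
move=> sdC sdD sCD; apply/eqP; rewrite eqEdim sCD /=.
by rewrite -leq_double !dim_self_dual.
Qed.

(** A self-dual code is totally isotropic, and isotropic vectors have even
    weight. *)
Lemma self_dual_type_IV C : type_IV C = self_dual C.
Proof.
rewrite /type_IV; case: (boolP (self_dual C)) => // sdC.
apply/forall_inP => v vC; apply/negP => odd_v.
have := self_dual_herm sdC vC vC.
by rewrite herm_diag // odd_v => /eqP; rewrite oner_eq0.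
Qed.

Lemma dim_addv_line U v : v \notin U -> \dim (U + <[v]>) = (\dim U).+1.
Proof.
move=> vU; have v_n0 : v != 0 by apply: contraNneq vU => ->; rewrite mem0v.
have := dimv_sum_cap U <[v]>; rewrite dim_vline v_n0 addn1 => <-.
suff -> : (U :&: <[v]> = 0)%VS by rewrite dimv0 addn0.
apply/eqP; rewrite -subv0; apply/subvP => x; rewrite memv_cap memv0.
case/andP => xU /vlineP[a def_x]; rewrite def_x scaler_eq0.
apply: contraNT vU; rewrite negb_or => /andP[a_n0 _].
by rewrite -(scalerK a_n0 v) -def_x memvZ.
Qed.

(** For an isotropic [v] outside of a self-dual [D] this is the only self-dual
    code that contains [v] and meets [D] in a hyperplane. *)
Definition switch D v : {vspace 'rV[F]_n} := (D :&: orthv v + <[v]>)%VS.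

Lemma memv_switch D v : v \in switch D v.
Proof. by rewrite (subvP (addvSr _ _)) ?memv_line. Qed.

Lemma switch_self_dual D v :
  self_dual D -> herm v v = 0 -> v \notin D -> self_dual (switch D v).
Proof.
move=> sdD vv vD; have Dv : ~~ (D <= orthv v)%VS by rewrite -self_dual_orthv.
apply: isotropic_self_dual; last first.
  rewrite dim_addv_line -?dimv_cap_orthv ?dim_self_dual //.
  by rewrite memv_cap negb_and vD.
move=> x' y' /memv_addP[x xDv [_ /vlineP[a ->] ->]].
case/memv_addP=> [y yDv [_ /vlineP[b ->] ->]]; move: xDv yDv.
rewrite !memv_cap !memv_orthv => /andP[xD /eqP xv] /andP[yD /eqP yv].
rewrite !(hermDl, hermDr) // !hermZl !hermZr // vv xv (hermC F4 y v) yv.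
by rewrite (self_dual_herm sdD) // expr0n /= !(mulr0, addr0).
Qed.

(** The inclusion of the left side in [D] is enough, both codes being
    self-dual.  An element d + a v of [switch D v] that is orthogonal to w has
    a = 0, since w is orthogonal to d but not to v. *)
Lemma switchK D v w :
  self_dual D -> herm v v = 0 -> w \in D -> herm v w != 0 ->
  switch (switch D v) w = D.
Proof.
move=> sdD vv wD vw.
have ww : herm w w = 0 by rewrite (self_dual_herm sdD).
have vD : v \notin D.
  by apply: contra vw => vD; rewrite (self_dual_herm sdD).
have wS : w \notin switch D v.
  apply: contra vw => wS.
  by rewrite (self_dual_herm (switch_self_dual sdD vv vD)) ?memv_switch.
apply: self_dual_sub_eq => //.
  exact: switch_self_dual (switch_self_dual sdD vv vD) ww wS.
rewrite subv_add -memvE wD andbT; apply/subvP => x'.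
rewrite memv_cap => /andP[/memv_addP[x + [_ /vlineP[a ->] ->]]].
rewrite memv_cap memv_orthv => /andP[xD _]; rewrite memv_orthv hermDl hermZl.
rewrite (self_dual_herm sdD) // add0r mulf_eq0 (negPf vw) orbF => /eqP->.
by rewrite scale0r addr0.
Qed.

Lemma dim_cap_switch C D v :
  self_dual C -> self_dual D -> v \in C -> v \notin D ->
  \dim (C :&: switch D v) = (\dim (C :&: D)).+1.
Proof.
move=> sdC sdD vC vD; rewrite -(@dim_addv_line _ v); last first.
  by rewrite memv_cap negb_and vD orbT.
congr (\dim _); apply/vspaceP => x; rewrite memv_cap.
apply/andP/memv_addP => [[xC /memv_addP[d + [_ /vlineP[a ->] def_x]]]|].
  rewrite memv_cap => /andP[dD _]; exists d; last first.
    by exists (a *: v); rewrite // memvZ ?memv_line.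
  by rewrite memv_cap dD andbT -(addrK (a *: v) d) -def_x memvB // memvZ.
case=> d; rewrite memv_cap => /andP[dC dD] [_ /vlineP[a ->] ->].
split; first by rewrite memvD // memvZ.
apply: memv_add; last by rewrite memvZ ?memv_line.
by rewrite memv_cap dD memv_orthv (self_dual_herm sdC) ?eqxx.
Qed.

End SelfDual.

(** * Counting self-dual codes by their intersection with a fixed one *)

Section Counting.
Variables (F : finFieldType) (n : nat).
Hypothesis F4 : #|F| = 4%N.
Implicit Types (u v w : 'rV[F]_n) (C D E U : {vspace 'rV[F]_n}).

Lemma card_nonorth U v :
  (4 * #|[set w in U | herm v w != 0%R]| = ~~ (U <= orthv v)%VS * 3 * #|U|)%N.
Proof.
have := card_cap_orthv F4 U v.
rewrite -(cardID (mem (orthv v)) (mem U)) /=.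
have -> : #|[set w in U | herm v w != 0]| = #|[predD U & orthv v]|.
  by apply: eq_card => w; rewrite !inE memv_orthv herm_eq0C // andbC.
have -> : #|(U :&: orthv v)%VS| = #|[predI U & orthv v]|.
  by apply: eq_card => w; rewrite memv_cap !inE.
move: #|[predI U & orthv v]| #|[predD U & orthv v]| => i d.
by case: (U <= _)%VS => /=; lia.
Qed.

Definition iso_nonorth v := [set w | (herm v w != 0) && (herm w w == 0)].

(** Translating w by a v changes the norm of w by the trace of a <v, w>.  With a
    chosen to make this trace 1, the translation is an involution that swaps the
    isotropic and the anisotropic vectors not orthogonal to v, so the former are
    half of the 3/4 of the space not orthogonal to v. *)
Lemma card_iso_nonorth v :
  herm v v = 0 -> (8 * #|iso_nonorth v| = (v != 0%R) * 3 * 4 ^ n)%N.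
Proof.
move=> vv; have [->|v_n0] := eqVneq v 0.
  rewrite mul0n; apply/eqP; rewrite muln_eq0 /= cards_eq0.
  apply/eqP/setP => w; rewrite !inE.
  by rewrite -(scale0r 0) hermZl mul0r eqxx.
(* The coefficient of v below gives a <v, w> the value t, of trace 1. *)
have [t tt1] := ex_trace1_F4 F4.
pose f w := w + (t / herm v w) *: v.
have vf w : herm v (f w) = herm v w by rewrite hermDr // hermZr // vv mulr0 addr0.
have ff w : herm v w != 0 -> herm (f w) (f w) = herm w w + 1.
  move=> vw; rewrite hermDl hermZl vf mulfVK //.
  rewrite hermDr // hermZr // (hermC F4 v w) -exprMn mulfVK //.
  by rewrite -addrA [_ + t]addrC tt1.
have fK : involutive f.
  move=> w; rewrite /f -/(f w) vf -addrA -scalerDl -mulr2n.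
  by rewrite -mulr_natr (pcharf0 (pchar_F4 F4)) mulr0 scale0r addr0.
pose S := [set w | herm v w != 0].
have herm01 w : (herm w w + 1 == 0) = (herm w w != 0).
  rewrite herm_diag //; case: odd; rewrite ?add0r ?oner_eq0 ?eqxx //.
  by rewrite -mulr2n (pcharf0 (pchar_F4 F4)) eqxx.
have swap : S :\: iso_nonorth v = f @: iso_nonorth v.
  apply/setP => w; rewrite -[w in RHS]fK mem_imset; last exact: inv_inj.
  rewrite !inE vf; have [|vw] /= := eqVneq (herm v w) 0; first by [].
  by rewrite ff // herm01 andbT.
have : (4 * #|S| = 3 * 4 ^ n)%N.
  have -> : S = [set w in {:'rV[F]_n}%VS | herm v w != 0].
    by apply/setP => w; rewrite !inE memvf.
  rewrite card_nonorth card_memv // dimvf /dim /= mul1n.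
  suff -> : ({:'rV[F]_n} <= orthv v)%VS = false by [].
  apply/negP => /subvP sub; have [u] := herm_nondegenerate v_n0.
  by rewrite -memv_orthv sub ?memvf.
rewrite -(cardsID (iso_nonorth v) S) swap (card_imset _ (inv_inj fK)).
have -> : S :&: iso_nonorth v = iso_nonorth v.
  by apply/setIidPr/subsetP => w; rewrite !inE => /andP[].
by lia.
Qed.

Definition meeting C (j : nat) := [set D | self_dual D & \dim (C :&: D) == j].

(** Switching by v and switching by w are mutually inverse bijections between
    the two families. *)
Lemma card_meeting_switch C v w j :
  self_dual C -> v \in C -> w \in iso_nonorth v ->
  #|[set D in meeting C j | w \in D]| = #|[set D in meeting C j.+1 | v \in D]|.
Proof.
move=> sdC vC; rewrite inE => /andP[vw /eqP ww].
have vv : herm v v = 0 by rewrite (self_dual_herm sdC).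
have notin u u' D : self_dual D -> herm u u' != 0 -> u' \in D -> u \notin D.
  by move=> sdD uu' u'D; apply: contra uu' => uD; rewrite (self_dual_herm sdD).
have wv : herm w v != 0 by rewrite herm_eq0C.
rewrite -(card_in_imset (f := fun D => switch D v)) /=; last first.
  move=> D E /[!inE] /andP[/andP[sdD _] wD] /andP[/andP[sdE _] wE].
  by move/(congr1 (fun D => switch D w)); rewrite !switchK.
apply: eq_card => E; apply/imsetP/idP => [[D + ->]|].
  rewrite !inE => /andP[/andP[sdD /eqP dimD] wD].
  have vD := notin v w D sdD vw wD.
  by rewrite memv_switch switch_self_dual //= dim_cap_switch ?dimD ?eqxx.
rewrite !inE => /andP[/andP[sdE /eqP dimE] vE].
have wE := notin w v E sdE wv vE.
have sdS : self_dual (switch E w) by rewrite switch_self_dual.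
have wS := memv_switch E w.
exists (switch E w); last by rewrite switchK.
rewrite !inE sdS wS andbT /= -eqSS -dimE -[in X in _ == X](switchK F4 sdE ww vE wv).
by rewrite (dim_cap_switch sdC sdS vC (notin v w _ sdS vw wS)).
Qed.

(** Sum the previous bijection over all v in C and all isotropic w not
    orthogonal to v.  On one side each D contributes the pairs with v in C
    outside of D and w in D not orthogonal to v, where w is isotropic for free;
    on the other side each D contributes the nonzero v in the intersection with
    C, with any admissible w. *)
Lemma card_meeting_rec C j (m := n./2) : self_dual C ->
  (2 * #|meeting C j| * (4 ^ m - 4 ^ j) =
   #|meeting C j.+1| * (4 ^ j.+1 - 1) * 4 ^ m)%N.
Proof.
move=> sdC.
have dimE D : self_dual D -> \dim D = m.
  by move=> sdD; rewrite -[LHS]doubleK dim_self_dual.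
have swap : (\sum_(v in C) \sum_(w in iso_nonorth v)
     #|[set D in meeting C j | w \in D]|
   = \sum_(v in C) \sum_(w in iso_nonorth v)
     #|[set D in meeting C j.+1 | v \in D]|)%N.
  by apply: eq_bigr => v vC; apply: eq_bigr => w wv; exact: card_meeting_switch.
have lhs : (4 * \sum_(v in C) \sum_(w in iso_nonorth v)
      #|[set D in meeting C j | w \in D]|
    = #|meeting C j| * ((4 ^ m - 4 ^ j) * 3 * 4 ^ m))%N.
  transitivity (4 * \sum_(v in C) \sum_(D in meeting C j)
      #|[set w in D | herm v w != 0%R]|)%N.
    congr muln; apply: eq_bigr => v vC.
    under eq_bigr do rewrite -sum1_card.
    under [RHS]eq_bigr do rewrite -sum1_card.
    rewrite (exchange_big_dep (mem (meeting C j))) /=; last first.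
      by move=> w D _; rewrite inE => /andP[].
    apply: eq_bigr => D DC; apply: eq_bigl => w; rewrite !inE.
    move: DC; rewrite inE => /andP[sdD ->]; rewrite sdD /=.
    case: (boolP (w \in D)) => wD; rewrite ?andbF //.
    by rewrite (self_dual_herm sdD wD wD) eqxx !andbT.
  rewrite exchange_big big_distrr -sum_nat_const /=; apply: eq_bigr => D.
  rewrite inE => /andP[sdD /eqP dimD].
  rewrite big_distrr /=.
  under eq_bigr do rewrite card_nonorth -self_dual_orthv // card_memv // dimE //.
  rewrite -!big_distrl /=; congr (_ * _ * _)%N.
  have <- : #|[predD C & D]| = (\sum_(v in C) (v \notin D))%N.
    rewrite -sum1_card [RHS]big_mkcond [LHS]big_mkcond /=; apply: eq_bigr => v _.
    by rewrite !inE andbC; case: (v \in C) => //=; case: (v \in D).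
  have := cardID (mem D) (mem C); rewrite /= card_memv // dimE // => <-.
  have -> : #|[predI C & D]| = (4 ^ j)%N.
    by rewrite -dimD -card_memv //; apply: eq_card => v; rewrite memv_cap !inE.
  by rewrite addKn.
have rhs : (8 * \sum_(v in C) \sum_(w in iso_nonorth v)
      #|[set D in meeting C j.+1 | v \in D]|
    = #|meeting C j.+1| * ((4 ^ j.+1 - 1) * 3 * 4 ^ n))%N.
  rewrite big_distrr /=.
  transitivity (\sum_(v in C) \sum_(D in meeting C j.+1 | v \in D)
      ((v != 0%R) * 3 * 4 ^ n))%N.
    apply: eq_bigr => v vC; rewrite sum_nat_const mulnA card_iso_nonorth; last first.
      by rewrite (self_dual_herm sdC).
    rewrite mulnC -sum_nat_const; apply: eq_bigl => D.
    by rewrite inE.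
  rewrite (exchange_big_dep (mem (meeting C j.+1))) /=; last by move=> v D _ /andP[].
  rewrite -sum_nat_const; apply: eq_bigr => D /[dup] DC.
  rewrite inE => /andP[sdD /eqP dimD].
  rewrite -!big_distrl /=; congr (_ * _ * _)%N.
  transitivity (\sum_(v in (C :&: D)%VS) (v != 0%R))%N.
    by apply: eq_bigl => v; rewrite memv_cap sdD dimD eqxx.
  rewrite -dimD -(card_memv F4 (C :&: D)) (cardD1 0%R) mem0v addnC addnK -sum1_card.
  rewrite big_mkcond [RHS]big_mkcond; apply: eq_bigr => v _; rewrite !inE.
  by case: (v == 0%R); case: (_ \in _).
have n2E : (4 ^ n = 4 ^ m * 4 ^ m)%N.
  by rewrite -expnD addnn -(dimE C sdC) dim_self_dual.
have m_gt0 : (0 < 4 ^ m)%N by rewrite expn_gt0.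
move: lhs rhs; rewrite swap n2E.
set S := (\sum_(v in C) _)%N; set a := #|meeting C j|; set b := #|meeting C j.+1|.
move: S a b (4 ^ m - 4 ^ j)%N (4 ^ j.+1 - 1)%N (4 ^ m)%N m_gt0.
move=> S a b x y q q_gt0 lhs rhs.
apply/eqP; rewrite -(eqn_pmul2r q_gt0) -(@eqn_pmul2l 3) //; apply/eqP.
by lia.
Qed.

End Counting.

(** * Handshake lemma *)

(** An edge is the image of exactly two ordered pairs of adjacent vertices. *)
Lemma double_card_edges (T : finType) (G : graph T) :
  {in gvert G &, symmetric (gadj G)} -> {in gvert G, irreflexive (gadj G)} ->
  (2 * #|edges G| = \sum_(x in gvert G) degree G x)%N.
Proof.
move=> symG irrG; rewrite mulnC -sum_nat_const.
under [RHS]eq_bigr do rewrite /degree -sum1dep_card.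
rewrite pair_big_dep /=.
rewrite (partition_big (fun p => [set p.1; p.2]) (mem (edges G))) /=; last first.
  case=> x y /= /and3P[xG yG xy]; apply/imset2P; exists x y => //.
  by rewrite inE yG.
apply: eq_bigr => e /imset2P[x y xG]; rewrite inE => /andP[yG xy] ->.
have xNy : x != y by apply: contraTneq xy => ->; rewrite irrG.
have -> : 2%N = #|[set (x, y); (y, x)]|.
  by rewrite cards2 xpair_eqE (negPf xNy).
rewrite -sum1_card; apply: eq_bigl => -[a b]; rewrite !inE !xpair_eqE /=.
apply/idP/idP => [/orP[] /andP[/eqP-> /eqP->]|/andP[/and3P[aG bG ab] /eqP def_e]].
- by rewrite xG yG xy eqxx.
- by rewrite xG yG symG // xy setUC eqxx.
have aNb : a != b by apply: contraTneq ab => ->; rewrite irrG.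
have := set21 a b; have := set22 a b; rewrite def_e !inE.
move: aNb; have [->|_] := eqVneq a x; have [->|_] := eqVneq b x => //=.
- by move=> _ ->.
- by move=> _ _ ->.
- by move=> + /eqP bE /eqP aE; rewrite aE bE eqxx.
Qed.

(** * Gaussian binomial coefficients in base 4 *)

(** This is 2^(k^2) times the Gaussian binomial coefficient of m and k in base 4,
    given by its Pascal rule, in which 2 * 4^m' absorbs the change of the
    power of 2. *)
Fixpoint hbinom m k : nat :=
  match m, k with
  | _, 0 => 1
  | 0, _.+1 => 0
  | m'.+1, k'.+1 => hbinom m' k'.+1 + 2 * 4 ^ m' * hbinom m' k'
  end.

Lemma hbinom0 m : hbinom m 0 = 1%N. Proof. by case: m. Qed.

Lemma hbinom_small m k : (m < k)%N -> hbinom m k = 0%N.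
Proof. by elim: m k => [|m IH] [|k] //= lt_mk; rewrite !IH ?muln0 // (ltnW lt_mk). Qed.

(** The Pascal rule multiplies the sum by 1 + 2 * 4^m when m increases. *)
Lemma sum_hbinom m :
  (\sum_(0 <= k < m.+1) hbinom m k = \prod_(0 <= i < m) (2 ^ (2 * i + 1) + 1))%N.
Proof.
elim: m => [|m IH]; first by rewrite big_nat1 big_geq.
rewrite [RHS]big_nat_recr //= -IH big_nat_recl //= big_split /= -big_distrr /=.
have -> : (\sum_(0 <= k < m.+1) hbinom m k.+1 = \sum_(1 <= k < m.+1) hbinom m k)%N.
  by rewrite big_nat_recr //= hbinom_small // addn0 big_add1.
rewrite addnA -{1}(hbinom0 m) -(big_ltn (F := hbinom m)) //.
by rewrite mulnDr muln1 addnC addn1 expnS expnM mulnC.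
Qed.

(** The ratio of consecutive terms, which the double count of codes produces
    too.  The induction on m needs besides it the ratio of [hbinom m.+1 k] to
    [hbinom m k], which follows from the Pascal rule and the induction
    hypothesis. *)
Lemma hbinom_rec m k : (k <= m)%N ->
  (hbinom m k.+1)%:R * (4 ^+ k.+1 - 1) =
  (hbinom m k)%:R * (2 * 4 ^+ k * (4 ^+ (m - k) - 1)) :> int.
Proof.
elim: m k => [|m IH] k le_km.
  by move: le_km; rewrite leqn0 => /eqP->; rewrite mul0r subrr !mulr0.
have shift : (hbinom m k)%:R * (4 ^+ m.+1 - 1) =
    (hbinom m.+1 k)%:R * (4 ^+ (m.+1 - k) - 1) :> int.
  case: k le_km => [|k] le_km; first by rewrite hbinom0 subn0.
  have /IH : (k <= m)%N by [].
  have [d ->] : exists d, m = (k + d)%N by exists (m - k)%N; lia.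
  rewrite subSS addKn /= natrD !natrM natrX !exprSr !exprD.
  set a := _%:R; set b := _%:R.
  move: (4 ^+ k) (4 ^+ d) => x y h.
  have -> : a * (x * y * 4 - 1) = a * (x * 4 - 1) * y + a * (y - 1) by ring.
  by rewrite h; ring.
move: le_km; rewrite leq_eqVlt => /predU1P[->|]; last rewrite ltnS => le_km.
  by rewrite hbinom_small // subnn subrr !mulr0 mul0r.
rewrite [hbinom m.+1 k.+1]/= natrD !natrM natrX mulrDl IH //.
transitivity (2 * 4 ^+ k * ((hbinom m k)%:R * (4 ^+ m.+1 - 1) : int)); last first.
  by rewrite shift; ring.
have -> : m.+1 = (k.+1 + (m - k))%N by lia.
have -> : 4 ^+ m = 4 ^+ k * 4 ^+ (m - k) :> int by rewrite -exprD subnKC.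
by rewrite !exprD !exprS; ring.
Qed.

(** Writing the powers of 2 as powers of 4, the factors of index i = j = k have
    the quotient of [hbinom m k.+1] by [hbinom m k]. *)
Lemma hbinom_prod m k : (k <= m)%N ->
  (hbinom m k)%:R =
    (\prod_(0 <= i < k) (2 ^+ (2 * m.*2 - 1 - 2 * i) - 2 ^+ (m.*2 - 1))) /
    (\prod_(0 <= j < k) (2 ^+ m.*2 - 2 ^+ (m.*2 - 2 - 2 * j))) :> rat.
Proof.
elim: k => [|k IH] lt_km; first by rewrite hbinom0 !big_geq // divr1.
have IHk := IH (ltnW lt_km); rewrite !big_nat_recr //= invfM mulrACA -IHk {IH IHk}.
have [d def_m] : exists d, m = (k + d.+1)%N by exists (m - k.+1)%N; lia.
have -> : (2 * m.*2 - 1 - 2 * k = 1 + 2 * (k + d + d.+1))%N by lia.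
have -> : (m.*2 - 1 = 1 + 2 * (k + d))%N by lia.
have -> : (m.*2 - 2 - 2 * k = 2 * d)%N by lia.
have -> : (m.*2 = 2 * (d + k.+1))%N by lia.
have pow4 i : 2 ^+ (2 * i) = 4 ^+ i :> rat by rewrite exprM -natrX.
have pow4S i : 2 ^+ (1 + 2 * i) = 2 * 4 ^+ i :> rat by rewrite exprS pow4.
rewrite !pow4S !pow4 !(exprD 4).
have d_n0 : 4 ^+ d != 0 :> rat by rewrite expf_neq0.
have k_n0 : 4 ^+ k.+1 - 1 != 0 :> rat.
  by rewrite subr_eq0 -natrX Num.Theory.pnatr_eq1 -(expn0 4) eqn_exp2l.
have := congr1 (fun z : int => z%:~R : rat) (hbinom_rec (ltnW lt_km)).
rewrite !rmorphM !rmorphB !rmorphXn /= !rmorph_nat rmorph1 def_m addKn => h.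
apply: (mulIf k_n0); rewrite {}h; field.
by rewrite -[X in _ - X]mulr1 -mulrBr mulf_neq0.
Qed.

(** * Vertices, degrees and edges *)

Section Vertices.
Variables (F : finFieldType) (n : nat).
Hypothesis F4 : #|F| = 4%N.
Implicit Types (C D : {vspace 'rV[F]_n}).

(** The repetition code (x | x): each coordinate product occurs twice, and the
    characteristic is 2. *)
Lemma self_dual_exists : ~~ odd n -> exists C, self_dual C.
Proof.
move=> /even_halfK <-; rewrite -addnn; move: n./2 => m.
pose f : 'Hom('rV[F]_m, 'rV[F]_(m + m)) := linfun (mulmxr (row_mx 1%:M 1%:M)).
have fE x : f x = row_mx x x by rewrite lfunE /= mul_mx_row mulmx1.
exists (limg f); apply: isotropic_self_dual => //.
  move=> _ _ /memv_imgP[x _ ->] /memv_imgP[y _ ->]; rewrite !fE.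
  rewrite /herm big_split_ord /=.
  under eq_bigr do rewrite !row_mxEl.
  under [X in _ + X]eq_bigr do rewrite !row_mxEr.
  by rewrite -mulr2n -mulr_natr (pcharf0 (pchar_F4 F4)) mulr0.
rewrite limg_dim_eq ?dimvf /dim /= ?mul1n ?addnn //.
apply/eqP; rewrite capfv; apply/lker0P => x y; rewrite !fE.
by case/eq_row_mx.
Qed.

(** Both sides are 1 for k = 0, as only C itself meets C in full dimension, and
    they satisfy the same first-order recurrence. *)
Lemma card_meeting_hbinom C k :
  self_dual C -> (k <= n./2)%N -> #|meeting C (n./2 - k)| = hbinom n./2 k.
Proof.
move=> sdC.
have dimE D : self_dual D -> \dim D = n./2.
  by move=> sdD; rewrite -[LHS]doubleK dim_self_dual.
elim: k => [_|k IH lt_km].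
  rewrite subn0 hbinom0 -[RHS](cards1 C); apply: eq_card => D; rewrite !inE.
  apply/andP/eqP => [[sdD /eqP dimCD]|->]; last by rewrite capvv dimE.
  apply/esym/self_dual_sub_eq => //; apply/capv_idPl/eqP.
  by rewrite eqEdim capvSl dimCD dimE /=.
have := card_meeting_rec F4 (n./2 - k.+1) sdC.
rewrite -subSn // subSS IH ?(ltnW lt_km) //.
have := hbinom_rec (ltnW lt_km); move: lt_km.
set a := #|_|; set b := hbinom _ _; set c := hbinom _ _.
move: a b c n./2 => a b c m lt_km h1.
have [d def_m] : exists d, m = (k.+1 + d)%N by exists (m - k.+1)%N; lia.
have -> : (m - k.+1 = d)%N by lia.
move: h1; have -> : (m - k = d.+1)%N by lia.
rewrite def_m !expnD.
have x_gt0 : (0 < 4 ^ k)%N by rewrite expn_gt0.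
have y_gt0 : (0 < 4 ^ d)%N by rewrite expn_gt0.
rewrite -!natrX !expnS; move: (4 ^ k)%N (4 ^ d)%N x_gt0 y_gt0 => x y x_gt0 y_gt0 h1 h2.
have {}h1 : (b * (4 * x - 1) = c * (2 * x * (4 * y - 1)))%N.
  apply/eqP; rewrite -(Num.Theory.eqr_nat int).
  by rewrite !natrM !natrB ?muln_gt0 ?x_gt0 ?y_gt0 // h1.
have p_gt0 : (0 < y * (4 * x - 1))%N by rewrite muln_gt0 y_gt0; lia.
apply/eqP; rewrite -(eqn_pmul2r p_gt0) -(@eqn_pmul2l 2) //; apply/eqP.
move: h1 h2; have -> : (4 * x * y - y = (4 * x - 1) * y)%N by rewrite mulnBl mul1n.
move: (4 * x - 1)%N (4 * y - 1)%N => p q h1 h2.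
have -> : (2 * (b * (y * p)) = 2 * y * (b * p))%N by lia.
by rewrite h1; lia.
Qed.

(** Sort the self-dual codes by the dimension of their intersection with a
    fixed one. *)
Lemma card_type_IV : ~~ odd n ->
  #|[set C | @type_IV F n C]| = (\prod_(0 <= i < n./2) (2 ^ (2 * i + 1) + 1))%N.
Proof.
case/self_dual_exists => C sdC; set m := n./2.
have dimE D : self_dual D -> \dim D = m.
  by move=> sdD; rewrite -[LHS]doubleK dim_self_dual.
rewrite -sum_hbinom big_mkord -sum1dep_card.
rewrite (partition_big (fun D => inord (m - \dim (C :&: D)) : 'I_m.+1) xpredT) //=.
apply: eq_bigr => k _; have k_le : (k <= m)%N by rewrite -ltnS.
rewrite -(card_meeting_hbinom sdC k_le) -sum1_card; apply: eq_bigl => D.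
rewrite inE self_dual_type_IV //; case: (boolP (self_dual D)) => //= sdD.
have le_dim : (\dim (C :&: D) <= m)%N by rewrite -(dimE C) // dimvS ?capvSl.
by rewrite -val_eqE /= inordK ?ltnS ?leq_subr //; lia.
Qed.

End Vertices.

Theorem theorem6p6 (F : finFieldType) (F4 : #|F| = 4%N) (n k : nat)
    (n_gt0 : (0 < n)%N) (n_even : n = 0 %[mod 2])
    (k_gt0 : (1 <= k)%N) (k_le : (k <= n./2)%N) :
  [/\ #|gvert (Gamma_IV F n k)| = (\prod_(0 <= i < n./2) (2 ^ (2 * i + 1) + 1))%N,
      forall C : {vspace 'rV[F]_n}, C \in gvert (Gamma_IV F n k) ->
        (degree (Gamma_IV F n k) C)%:R =
          (\prod_(0 <= i < k) (2 ^+ (2 * n - 1 - 2 * i) - 2 ^+ (n - 1))) /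
          (\prod_(0 <= j < k) (2 ^+ n - 2 ^+ (n - 2 - 2 * j))) :> rat
    & #|edges (Gamma_IV F n k)|%:R =
        1 / 2 * (\prod_(0 <= i < n./2) (2 ^+ (2 * i + 1) + 1)) *
        ((\prod_(0 <= i < k) (2 ^+ (2 * n - 1 - 2 * i) - 2 ^+ (n - 1))) /
         (\prod_(0 <= j < k) (2 ^+ n - 2 ^+ (n - 2 - 2 * j)))) :> rat].
Proof.
have even_n : ~~ odd n by move: n_even; rewrite mod0n modn2; case: odd.
have vertG C : (C \in gvert (Gamma_IV F n k)) = self_dual C.
  by rewrite inE self_dual_type_IV.
have degG C : self_dual C -> degree (Gamma_IV F n k) C = hbinom n./2 k.
  move=> sdC; rewrite -(card_meeting_hbinom F4 sdC k_le) /degree.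
  apply: eq_card => D; rewrite [LHS]inE vertG [RHS]inE /= /neighbors sdC.
  by case: (self_dual D).
have degQ := hbinom_prod k_le; rewrite even_halfK // in degQ.
have cardV := card_type_IV F4 even_n.
split=> // [C|]; first by rewrite vertG => /degG->.
have symG : {in gvert (Gamma_IV F n k) &, symmetric (gadj (Gamma_IV F n k))}.
  by move=> C D _ _ /=; rewrite /neighbors andbCA capvC.
have irrG : {in gvert (Gamma_IV F n k), irreflexive (gadj (Gamma_IV F n k))}.
  move=> C; rewrite vertG /= /neighbors capvv => sdC; rewrite sdC /=.
  by have := dim_self_dual F4 sdC; lia.
have := double_card_edges symG irrG.
under eq_bigr => C do [rewrite vertG => /degG->].
rewrite sum_nat_const cardV => /(congr1 (fun i : nat => i%:R : rat)).
rewrite !natrM -degQ natr_prod.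
under eq_bigr do rewrite natrD natrX.
move=> edgesE; apply: (@mulfI _ (2 : rat)) => //; rewrite edgesE.
by field.
Qed.
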